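(* Let $X$ be a finite set of variables, let $\preccurlyeq$ be a monomial ordering on the monomials in $X$, and let $F\subseteq\mathbb{Z}_2[X]$ be any set of polynomials. Let $\mathcal S_F$ be the set of polynomials that are not residual with respect to $F$, and let $\mathrm{Min}_{\triangleleft}(\mathcal S_F)=\{p\in\mathcal S_F : \text{for all } q\in\mathcal S_F,\ q\triangleleft p \Rightarrow q=p\}$. Then $$|\mathrm{Gb}(F)|=|\mathrm{Min}_{\triangleleft}(\mathcal S_F)|.$$
   Context: $\mathbb{Z}_2$ is the field with two elements. A monomial ordering is a total order $\preccurlyeq$ on monomials with $1\preccurlyeq t$ for all $t$ and $t_1\preccurlyeq t_2\Rightarrow t_1t_3\preccurlyeq t_2t_3$. For a nonzero polynomial $g$, $\mathcal{HT}(g)$ is its highest monomial w.r.t. $\preccurlyeq$. The ordering is extended to polynomials by: $g\preccurlyeq f$ iff $g=f$, or $\mathcal{HT}(g)\prec\mathcal{HT}(f)$, or $\mathcal{HT}(g)=\mathcal{HT}(f)=t$ and $g-t\preccurlyeq f-t$ (recursively; the zero polynomial is below every nonzero polynomial). A polynomial $f$ is residual w.r.t. $F$ if for every $g\in\mathbb{Z}_2[X]$ with $f+g\in\langle F\rangle$ (the ideal generated by $F$) we have $f\preccurlyeq g$. For polynomials $p,q$, $p\triangleleft q$ means there is an injective map $\phi$ from the set of monomials occurring in $p$ to the set of monomials occurring in $q$ such that each monomial $t$ divides $\phi(t)$. $\mathrm{Gb}(F)$ denotes the reduced Gröbner basis of $\langle F\rangle$ w.r.t. $\preccurlyeq$.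 *)

(* Defs.v *)
From HB Require Import structures.
From mathcomp Require Import all_boot all_order all_algebra.
From mathcomp Require Import boolp classical_sets functions cardinality.
From mathcomp.multinomials Require Import mpoly.

Set Implicit Arguments.
Unset Strict Implicit.
Unset Printing Implicit Defensive.

Import GRing.Theory.

Local Open Scope classical_set_scope.
Local Open Scope ring_scope.

(* Monomials are exponent vectors ['X_{1..n}], written additively: the monomial
   1 is [0%MM], the product is [(t1 + t2)%MM], and divisibility is the
   componentwise order [(t1 <= t2)%MM]. *)
Record monomial_ordering (n : nat) (le : rel 'X_{1..n}) : Prop := {
  mord_refl : reflexive le;
  mord_anti : antisymmetric le;
  mord_trans : transitive le;
  mord_total : total le;
  mord_one : forall t, le 0%MM t;
  mord_mul : forall t1 t2 t3, le t1 t2 -> le (t1 + t3)%MM (t2 + t3)%MM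
}.

Section Definitions.

Variables (n : nat) (le : rel 'X_{1..n}).

Implicit Types (f g p q : {mpoly 'F_2[n]}) (t : 'X_{1..n}).
Implicit Types (F G S : set {mpoly 'F_2[n]}).

(* Since [0%MM] is least for a monomial ordering, starting the maximum from it
   does not change the result when [f != 0]; [HT 0] is junk. *)
Definition HT f : 'X_{1..n} :=
  \big[(fun t1 t2 => if le t1 t2 then t2 else t1) / 0%MM]_(t <- msupp f) t.

(* Over 'F_2 the term of [f] at its highest monomial [t] is ['X_[t]] itself. *)
Inductive poly_le : {mpoly 'F_2[n]} -> {mpoly 'F_2[n]} -> Prop :=
| poly_le_refl f : poly_le f f
| poly_le_zero f : poly_le 0 f
| poly_le_HT g f : g != 0 -> f != 0 ->
    HT g != HT f -> le (HT g) (HT f) -> poly_le g f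
| poly_le_tail g f : g != 0 -> f != 0 -> HT g = HT f ->
    poly_le (g - 'X_[HT g]) (f - 'X_[HT f]) -> poly_le g f.

Definition ideal_gen F : set {mpoly 'F_2[n]} :=
  [set f | exists2 s : seq ({mpoly 'F_2[n]} * {mpoly 'F_2[n]}),
             forall hg, hg \in s -> F hg.2
           & f = \sum_(hg <- s) hg.1 * hg.2].

Definition residual F f : Prop :=
  forall g, ideal_gen F (f + g) -> poly_le f g.

Definition nonresidual F : set {mpoly 'F_2[n]} := [set f | ~ residual F f].

Definition tri p q : Prop :=
  exists2 phi : 'X_{1..n} -> 'X_{1..n},
    {in msupp p &, injective phi}
  & forall t, t \in msupp p -> phi t \in msupp q /\ (t <= phi t)%MM.

Definition Min_tri S : set {mpoly 'F_2[n]} :=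
  [set p | S p /\ forall q, S q -> tri q p -> q = p].

Definition HT_ideal G : set {mpoly 'F_2[n]} :=
  ideal_gen [set 'X_[HT g] | g in [set g | G g /\ g != 0]].

Definition groebner_basis F G : Prop :=
  [/\ finite_set G, G `<=` ideal_gen F & HT_ideal G = HT_ideal (ideal_gen F)].

(* The condition [g@_(HT g) = 1] (monic) in particular excludes [g = 0]. *)
Definition reduced_groebner_basis F G : Prop :=
  groebner_basis F G /\
  forall g, G g -> g@_(HT g) = 1 /\
    forall t, t \in msupp g -> ~ HT_ideal (G `\ g) 'X_[t].

(* For a monomial ordering exactly one set satisfies [reduced_groebner_basis F]
   (a classical fact), so the default value [set0] of [xget] is never used. *)
Definition Gb F : set {mpoly 'F_2[n]} :=
  xget set0 [set G | reduced_groebner_basis F G].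

End Definitions.

(* Main.v *)
(** Over Z_2 a polynomial is a finite set of monomials, and [p] strictly precedes
    [q] iff the highest monomial of [p - q] occurs in [q].  Hence [f] fails to
    be residual iff one of its monomials lies in the set [M] of highest
    monomials of the ideal ([lead] below), so that the [tri]-minimal
    non-residual polynomials are the monomials minimal for divisibility in [M].
    The highest monomials of a reduced Groebner basis are, without repetition,
    these same monomials.  Because [Gb] is defined by choice, a reduced basis
    must also be shown to exist: Dickson's lemma makes the minimal monomials [m]
    finite in number and [le] well-founded, and the basis consists of the
    [m - r], with [r] a normal form of [m]. *)

Require Import Defs.
From mathcomp Require Import all_boot all_order all_algebra.
From mathcomp Require Import boolp classical_sets functions cardinality.
From mathcomp.multinomials Require Import mpoly.

Local Open Scope card_scope.

Section ReducedGroebnerBases.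
Set Implicit Arguments.
Unset Strict Implicit.
Unset Printing Implicit Defensive.

Import GRing.Theory.

Local Open Scope classical_set_scope.
Local Open Scope ring_scope.

(** * Dickson's lemma and minimal monomials *)

Lemma nat_nondecreasing_subseq (u : nat -> nat) :
  exists2 s : nat -> nat,
    {homo s : i j / (i < j)%N} & {homo u \o s : i j / (i <= j)%N}.
Proof.
(* Beyond every index the values of [u] attain a minimum. Jumping repeatedly to such an index gives
   the subsequence; the count [i.+1] makes its first term a tail minimum too. *)
have tail_min i : exists j, (i < j)%N /\ forall k, (i < k)%N -> (u j <= u k)%N.
  have exv : exists v, `[< exists2 k, (i < k)%N & u k = v >].
    by exists (u i.+1); apply/asboolP; exists i.+1.
  case: (ex_minnP exv) => _ /asboolP[j ltij <-] minj.
  by exists j; split=> // k ltik; apply: minj; apply/asboolP; exists k.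
have [f fP] := choice tail_min.
have s_incr i : (iter i.+1 f 0 < iter i.+2 f 0)%N.
  by case: (fP (iter i.+1 f 0%N)).
exists (fun i => iter i.+1 f 0%N).
  by apply: (homo_ltn ltn_trans) => i; exact: s_incr.
apply: (homo_leq leqnn leq_trans) => i /=.
have [_ /(_ (iter i.+2 f 0%N))] := fP (iter i f 0%N); apply.
by apply: ltn_trans (s_incr i); case: (fP (iter i f 0%N)).
Qed.

(** Induction on [k] finds a subsequence along which the first [k] exponents are nondecreasing: each
    further exponent costs one more extraction, which preserves the monotonicity already gained. *)
Lemma dickson (n : nat) (f : nat -> 'X_{1..n}) :
  exists i j, (i < j)%N /\ (f i <= f j)%MM.
Proof.
suff /(_ n) [s s_incr fs_mono] k : exists2 s : nat -> nat,
    {homo s : i j / (i < j)%N} &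
    forall l : 'I_n, (l < k)%N ->
      {homo (fun i => f (s i) l) : i j / (i <= j)%N}.
  exists (s 0%N), (s 1%N); split; first exact: s_incr.
  by apply/mnm_lepP => l; apply: fs_mono.
elim: k => [|k [s s_incr fs_mono]]; first by exists id.
have [ltkn|lenk] := ltnP k n; last first.
  by exists s => // l _; apply: fs_mono; apply: leq_trans lenk.
have [s' s'_incr fs'_mono] :=
  nat_nondecreasing_subseq (fun i => f (s i) (Ordinal ltkn)).
exists (s \o s') => [i j ltij|l]; first exact/s_incr/s'_incr.
rewrite ltnS leq_eqVlt => /predU1P[lk|ltlk] i j leij.
  by rewrite (_ : l = Ordinal ltkn); [exact: fs'_mono|exact: val_inj].
apply: (fs_mono _ ltlk).
by move: leij; rewrite leq_eqVlt => /predU1P[->//|/s'_incr/ltnW].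
Qed.

(** An infinite [A] contains an injective sequence; [dickson] finds two comparable terms in it,
    which the antichain condition makes equal. *)
Lemma antichain_finite (n : nat) (A : set 'X_{1..n}) :
  (forall t u, A t -> A u -> (t <= u)%MM -> t = u) -> finite_set A.
Proof.
move=> antiA; apply: contrapT => /infiniteP/card_leP[f].
pose g k := val (f (SigSub (mem_set (I : [set: nat] k)))).
have gA k : A (g k) by exact/set_mem/valP.
have [i [j [ltij leij]]] := dickson g.
have /val_inj eqf := antiA _ _ (gA i) (gA j) leij.
have /(congr1 val)/= eqij := @inj _ _ _ f _ _ (in_setT _) (in_setT _) eqf.
by rewrite eqij ltnn in ltij.
Qed.

Lemma exists_minimal_divisor (n : nat) (A : set 'X_{1..n}) t : A t ->
  exists2 m, (m <= t)%MM & A m /\ forall u, A u -> (u <= m)%MM -> u = m.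
Proof.
have [d] := ubnP (mdeg t); elim: d t => // d IHd t; rewrite ltnS => letd At.
have [mint|/existsNP[u /not_implyP[Au /not_implyP[leut neut]]]] :=
  pselect (forall u, A u -> (u <= t)%MM -> u = t).
  by exists t; first exact: lepm_refl.
have [|m lemu minm] := IHd u _ Au.
  2: by exists m => //; apply: lepm_trans leut.
apply: leq_trans letd; rewrite -(submK leut) mdegD addnC.
rewrite -[ltnLHS]addn0 ltn_add2l.
rewrite lt0n mdeg_eq0; apply/eqP => eq0; apply: neut.
by rewrite -(submK leut) eq0 add0m.
Qed.

(** * Monomial orderings: well-foundedness and highest monomials *)

Section MonomialOrdering.
Variables (n : nat) (le : rel 'X_{1..n}) (Hle : monomial_ordering le).
Implicit Types (t u m : 'X_{1..n}) (f g h p q r : {mpoly 'F_2[n]}).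
Implicit Types (F G : set {mpoly 'F_2[n]}).

Lemma mord_dvd t u : (t <= u)%MM -> le t u.
Proof.
move=> /submK <-; rewrite -[X in le X _]add0m.
exact/(mord_mul Hle)/(mord_one Hle).
Qed.

(** A counterexample would start an infinite strictly descending sequence, whereas [dickson] gives a
    term dividing, hence below, a later one. *)
Lemma mord_ind (P : 'X_{1..n} -> Prop) :
  (forall t, (forall u, le u t -> u <> t -> P u) -> P t) -> forall t, P t.
Proof.
move=> IH t0; apply: contrapT => nPt0.
have descend t : exists u, ~ P t -> [/\ ~ P u, le u t & u <> t].
  have [Pt|nPt] := pselect (P t); first by exists t.
  have /existsNP[u /not_implyP[leut /not_implyP[neut nPu]]] :=
    contra_not (IH t) nPt.
  by exists u.
have [d dP] := choice descend.
have nP i : ~ P (iter i d t0) by elim: i => //= i /dP[].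
have [i [j [ltij /mord_dvd leij]]] := dickson (fun i => iter i d t0).
have le_decr : {homo (fun k => iter k d t0) : a b / (a <= b)%N >-> le b a}.
  apply: homo_leq => [||k]; first exact: (mord_refl Hle).
  - by move=> y x z lexy lezy; apply: (mord_trans Hle) lezy lexy.
  - by case: (dP _ (nP k)).
have /= := le_decr _ _ ltij; have [_ ledi nedi] := dP _ (nP i).
move=> lejd; apply: nedi; apply: (mord_anti Hle).
by rewrite ledi /= (mord_trans Hle leij).
Qed.

Lemma HT_max f t : t \in msupp f -> le t (HT le f).
Proof.
rewrite /HT; elim: (msupp f) => // u s IHs.
rewrite in_cons big_cons; set v := (X in le u X) => /predU1P[->|/IHs let_].
  by case: ifP => // _; exact: (mord_refl Hle).
case: ifPn => // /negPf nle; apply: (mord_trans Hle let_).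
by have := mord_total Hle u v; rewrite nle.
Qed.

Lemma HT_msupp f : f != 0 -> HT le f \in msupp f.
Proof.
rewrite -msupp_eq0 /HT; elim: (msupp f) => // u s IHs _.
rewrite big_cons; case: ifPn => [leu|_]; last exact: mem_head.
rewrite in_cons; case: s IHs leu => [_|v s IHs leu]; last by rewrite IHs ?orbT.
(* On a one-element support the maximum may return its initial value [0%MM]; as this is least, it
   equals [u]. *)
rewrite big_nil => leu0; rewrite (_ : 0%MM = u) ?eqxx //.
by apply: (mord_anti Hle); rewrite leu0 (mord_one Hle).
Qed.

Lemma HT_eq f t :
  t \in msupp f -> (forall u, u \in msupp f -> le u t) -> HT le f = t.
Proof.
move=> tf maxt; apply: (mord_anti Hle); rewrite HT_max // andbT maxt //.
by apply: HT_msupp; apply: contraTneq tf => ->; rewrite msupp0.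
Qed.

(** * Polynomials over Z_2 as finite sets of monomials *)

Lemma F2_eq1 (x : 'F_2) : x != 0 -> x = 1.
Proof. by case: x => [[|[|]]] //= *; exact/val_inj. Qed.

Lemma mcoeff_F2 f t : f@_t = (t \in msupp f)%:R.
Proof.
by rewrite mcoeff_msupp; have [->|/F2_eq1->] := eqVneq f@_t 0.
Qed.

Lemma msuppB_F2 f g t :
  (t \in msupp (f - g)) = (t \in msupp f) (+) (t \in msupp g).
Proof. by rewrite mcoeff_msupp mcoeffB !mcoeff_F2; do 2 case: (_ \in _). Qed.

Lemma addr_F2 f g : f + g = f - g.
Proof.
apply/mpolyP => t; rewrite mcoeffD mcoeffB.
by congr (_ + _); case: g@_t => [[|[|]]] //= *; exact/val_inj.
Qed.

Lemma HT_X t : HT le ('X_[t] : {mpoly 'F_2[n]}) = t.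
Proof.
apply: HT_eq => [|u]; rewrite msuppX ?mem_head // inE => /eqP->.
exact: (mord_refl Hle).
Qed.

Lemma mpolyX_neq0 t : ('X_[t] : {mpoly 'F_2[n]}) != 0.
Proof. by rewrite -msupp_eq0 msuppX. Qed.

Lemma neq0_msupp f t : t \in msupp f -> f != 0.
Proof. by apply: contraTneq => ->; rewrite msupp0. Qed.

(** Removing a common highest monomial from [g] and [f] leaves [g - f] unchanged; once the highest
    monomials differ, the larger one is the highest monomial of [g - f]. *)
Lemma poly_leP g f : poly_le le g f <-> g = f \/ HT le (g - f) \in msupp f.
Proof.
split.
  elim=> {g f} [f|f|g f g0 f0 neHT leHT|g f g0 f0 eqHT _ IH].
  - by left.
  - have [->|f0] := eqVneq f 0; [by left|right].
    by rewrite -addr_F2 add0r HT_msupp.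
  - right; have gHT : HT le f \notin msupp g.
      apply: contra neHT => /HT_max leHT'; apply/eqP/(mord_anti Hle).
      by rewrite leHT.
    suff -> : HT le (g - f) = HT le f by exact: HT_msupp.
    apply: HT_eq; first by rewrite msuppB_F2 (negPf gHT) HT_msupp.
    move=> u; rewrite msuppB_F2.
    case: (boolP (u \in msupp g)) => [ug _|_ /HT_max//].
    exact: (mord_trans Hle) (HT_max ug) leHT.
  - move: IH; rewrite eqHT; case=> [/addIr->|]; first by left.
    rewrite opprB addrA subrK msuppB_F2 msuppX inE.
    case: eqP => [-> _|_]; last by rewrite addbF; right.
    by right; exact: HT_msupp.
(* Each use of [poly_le_tail] removes one monomial from [f], so induct on their number. *)
have [k] := ubnP (size (msupp f)); elim: k f g => // k IHk f g lek.
have [->|neq] := eqVneq g f; first by move=> _; exact: poly_le_refl.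
case=> [/eqP|gf]; first by rewrite (negPf neq).
have [->|g0] := eqVneq g 0; first exact: poly_le_zero.
have f0 := neq0_msupp gf; rewrite -subr_eq0 in neq.
have [eqHT|neHT] := eqVneq (HT le g) (HT le f).
  apply: poly_le_tail => //; apply: IHk; last right.
    have <- : f@_(HT le f) *: 'X_[HT le f] = 'X_[HT le f].
      by rewrite mcoeff_F2 HT_msupp ?scale1r.
    rewrite (perm_size (msupp_rem _ _)) size_rem ?HT_msupp //.
    by case: (msupp f) gf lek.
  have -> : g - 'X_[HT le g] - (f - 'X_[HT le f]) = g - f.
    by rewrite eqHT opprB addrA subrK.
  (* The removed monomial occurs in both [g] and [f], so it cancels in [g - f] and cannot be its
     highest monomial. *)
  rewrite msuppB_F2 gf msuppX inE.
  have := HT_msupp neq; rewrite msuppB_F2.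
  by case: eqP => // ->; rewrite -{1}eqHT !HT_msupp.
apply: poly_le_HT => //.
have [//|nle] := boolP (le (HT le g) (HT le f)).
have leHT : le (HT le f) (HT le g).
  by have := mord_total Hle (HT le g) (HT le f); rewrite (negPf nle).
have gNf : HT le g \notin msupp f.
  by apply: contra nle => /HT_max.
suff eqg : HT le (g - f) = HT le g by rewrite eqg (negPf gNf) in gf.
apply: HT_eq; first by rewrite msuppB_F2 (negPf gNf) HT_msupp.
move=> u; rewrite msuppB_F2;
  case: (boolP (u \in msupp g)) => [/HT_max//|_ /HT_max leu].
exact: (mord_trans Hle) leu leHT.
Qed.

(** * Ideals, their highest monomials, and residual polynomials *)

Section Ideals.
Variable F : set {mpoly 'F_2[n]}.

Lemma ideal_gen_mem f : F f -> ideal_gen F f.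
Proof.
move=> Ff; exists [:: (1, f)]; last by rewrite big_seq1 mul1r.
by move=> hg; rewrite inE => /eqP->.
Qed.

Lemma ideal_gen0 : ideal_gen F 0.
Proof. by exists [::] => //; rewrite big_nil. Qed.

Lemma ideal_genD f g : ideal_gen F f -> ideal_gen F g -> ideal_gen F (f + g).
Proof.
move=> [s sF ->] [s' s'F ->]; exists (s ++ s'); last by rewrite big_cat.
by move=> hg; rewrite mem_cat => /orP[/sF|/s'F].
Qed.

Lemma ideal_genM h f : ideal_gen F f -> ideal_gen F (h * f).
Proof.
move=> [s sF ->]; exists [seq (h * hg.1, hg.2) | hg <- s].
  by move=> _ /mapP[hg /sF ? ->].
by rewrite big_map mulr_sumr; apply: eq_bigr => hg _; rewrite mulrA.
Qed.

Lemma ideal_gen_sum (s : seq ({mpoly 'F_2[n]} * {mpoly 'F_2[n]})) :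
  (forall hg, hg \in s -> ideal_gen F hg.2) ->
  ideal_gen F (\sum_(hg <- s) hg.1 * hg.2).
Proof.
elim: s => [|hg s IHs] sF; first by rewrite big_nil; exact: ideal_gen0.
rewrite big_cons; apply: ideal_genD; first by apply/ideal_genM/sF/mem_head.
by apply: IHs => hg' hg's; apply: sF; rewrite in_cons hg's orbT.
Qed.

End Ideals.

Lemma ideal_gen_sub F G : F `<=` ideal_gen G -> ideal_gen F `<=` ideal_gen G.
Proof. by move=> FG _ [s sF ->]; apply: ideal_gen_sum => hg /sF/FG. Qed.

(** When ['X_[t]] is a combination of the generators, [t] must occur in some summand, and every
    monomial of that summand is a multiple of its generator. *)
Lemma HT_idealP G t :
  HT_ideal le G 'X_[t] <-> exists g, [/\ G g, g != 0 & (HT le g <= t)%MM].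
Proof.
split=> [[s sG eqt]|[g [Gg g0 let_]]]; last first.
  rewrite -(submK let_) mpolyXD; apply/ideal_genM/ideal_gen_mem.
  by exists g.
have : t \in msupp ('X_[t] : {mpoly 'F_2[n]}) by rewrite msuppX mem_head.
rewrite eqt => /msupp_sum_le/flattenP[_ /mapP[hg hgs ->]].
have [g [Gg g0] <-] : [set 'X_[HT le g] | g in [set g | G g /\ g != 0]] hg.2.
  by apply: sG; move: hgs; rewrite mem_filter.
move=> /msuppM_le/allpairsP[[u v] /= [_]]; rewrite msuppX inE => /eqP-> ->.
by exists g; split=> //; exact: lem_addl.
Qed.

Definition lead F : set 'X_{1..n} :=
  [set t | exists g, [/\ ideal_gen F g, g != 0 & HT le g = t]].

Lemma lead_dvd F t u : lead F t -> (t <= u)%MM -> lead F u.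
Proof.
move=> [g [Fg g0 <-]] /submK <-; set v := (u - _)%MM.
have supp w :
  w \in msupp ('X_[v] * g) = (w \in [seq (v + w)%MM | w <- msupp g]).
  by rewrite mulrC (perm_mem (msuppMX _ _)).
have HTvg : (v + HT le g)%MM \in msupp ('X_[v] * g).
  by rewrite supp; apply/map_f/HT_msupp.
exists ('X_[v] * g); split; [exact: ideal_genM|exact: neq0_msupp HTvg|].
apply: HT_eq => // w; rewrite supp => /mapP[z /HT_max lez ->].
by rewrite ![(v + _)%MM]addmC; exact: (mord_mul Hle).
Qed.

Lemma HT_ideal_lead F t : HT_ideal le (ideal_gen F) 'X_[t] <-> lead F t.
Proof.
rewrite HT_idealP; split=> [[g [Fg g0]]|[g [Fg g0 <-]]].
  by apply: lead_dvd; exists g.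
by exists g; split=> //; exact: lepm_refl.
Qed.

(** By [poly_leP], a polynomial [g] violates residuality exactly when [f - g] is a nonzero ideal
    element whose highest monomial lies in [f]. Conversely, an ideal element [g] with highest
    monomial in [f] yields the violation [f - g]. *)
Lemma nonresidualP F f :
  nonresidual le F f <-> exists2 t, t \in msupp f & lead F t.
Proof.
split=> [nres|[t tf [g [Fg g0 eqt]]] res]; last rewrite -{}eqt in tf.
  apply: contrapT => nlead; apply: nres => g; rewrite addr_F2 => Ffg.
  apply/poly_leP; have [->|neq] := eqVneq f g; [by left|right].
  rewrite -subr_eq0 in neq.
  have := HT_msupp neq; rewrite msuppB_F2.
  case: (boolP (_ \in msupp f)) => // HTf _; case: nlead.
  by exists (HT le (f - g)) => //; exists (f - g).
have /poly_leP : poly_le le f (f - g) by apply: res; rewrite addr_F2 subKr.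
case=> [/esym/eqP|].
  by rewrite -subr_eq0 addrC addKr oppr_eq0 (negPf g0).
by rewrite subKr msuppB_F2 tf HT_msupp.
Qed.

(** * Minimal non-residual polynomials *)

Definition min_lead F : set 'X_{1..n} :=
  [set t | lead F t /\ forall u, lead F u -> (u <= t)%MM -> u = t].

(** An injection into a one-element support leaves room for at most one monomial in [p]. *)
Lemma tri_X p t : tri p 'X_[t] -> p = 0 \/ exists2 u, p = 'X_[u] & (u <= t)%MM.
Proof.
move=> [phi phi_inj phi_le].
have phit u : u \in msupp p -> phi u = t /\ (u <= t)%MM.
  by move=> /phi_le[]; rewrite msuppX inE => /eqP->.
have [->|/HT_msupp] := eqVneq p 0; first by left.
set u := HT le p => pu; right; exists u; last by case: (phit u pu).
apply/mpolyP => v; rewrite mcoeff_F2 mcoeffX; congr (_%:R); congr nat_of_bool.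
apply/idP/eqP => [pv|<-//]; apply: phi_inj => //.
by rewrite (phit u pu).1 (phit v pv).1.
Qed.

Lemma X_tri p t : t \in msupp p -> tri 'X_[t] p.
Proof.
move=> pt; exists id; first by move=> ? ?.
by move=> u; rewrite msuppX inE => /eqP->; split=> //; exact: lepm_refl.
Qed.

Lemma X_nonresidual F t : nonresidual le F 'X_[t] <-> lead F t.
Proof.
rewrite nonresidualP; split=> [[u]|]; first by rewrite msuppX inE => /eqP->.
by exists t => //; rewrite msuppX mem_head.
Qed.

(** A non-residual [p] contains a monomial of [lead F], itself non-residual and [tri]-below [p], so
    a minimal [p] equals it. Between monomials, [tri] is divisibility. *)
Lemma Min_tri_nonresidual F :
  Min_tri (nonresidual le F) = [set 'X_[t] | t in min_lead F].
Proof.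
apply/seteqP; split=> [p [/nonresidualP[t pt Ft] minp]|_ [t [Ft mint] <-]].
  have eqp := minp _ ((X_nonresidual F t).2 Ft) (X_tri pt).
  exists t => //; split=> // u Fu leut.
  have := minp _ ((X_nonresidual F u).2 Fu).
  rewrite -eqp => /(_ _)/(congr1 (HT le)); rewrite !HT_X; apply.
  exists (fun=> t) => [v w|v]; rewrite !msuppX !inE.
    by move=> /eqP-> /eqP->.
  by move=> /eqP->.
split=> [|q Fq /tri_X[q0|[u equ leut]]]; first exact/X_nonresidual.
  (* The zero polynomial is [tri]-below everything, but it is residual. *)
  by move: Fq; rewrite q0 => /nonresidualP[u]; rewrite msupp0.
by rewrite equ in Fq *; rewrite (mint u) //; exact/X_nonresidual.
Qed.

(** * Reduced Groebner bases: their highest monomials and their existence *)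

Lemma reduced_HT F G : reduced_groebner_basis le F G ->
  {in G &, injective (HT le)} /\ HT le @` G = min_lead F.
Proof.
move=> [[_ GF HTG] red].
have G0 g : G g -> g != 0.
  move=> /red[+ _]; apply: contra_eq_neq => ->.
  by rewrite mcoeff0 eq_sym oner_neq0.
(* Reducedness at the monomial [HT le g] itself; both injectivity and minimality follow from
   this. *)
have eq_dvd g g' : G g -> G g' -> (HT le g' <= HT le g)%MM -> g' = g.
  move=> Gg Gg' le_; apply: contrapT => neq.
  case: (red g Gg) => _ /(_ _ (HT_msupp (G0 g Gg))); apply.
  by apply/HT_idealP; exists g'; split=> //; exact: G0.
have leadG g : G g -> lead F (HT le g).
  by move=> Gg; exists g; split=> //; [exact: GF|exact: G0].
have dvdG t : lead F t -> exists2 g, G g & (HT le g <= t)%MM.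
  by rewrite -HT_ideal_lead -HTG => /HT_idealP[g []]; exists g.
split=> [g g' /set_mem Gg /set_mem Gg' eqHT|].
  by apply: eq_dvd => //; rewrite eqHT; exact: lepm_refl.
apply/seteqP; split=> [_ [g Gg <-]|t [Ft mint]].
  split=> [|u /dvdG[g' Gg' leu] leug]; first exact: leadG.
  (* In the chain of divisors [HT le g'], [u], [HT le g] the two ends agree by [eq_dvd]. *)
  apply/mnmP => i; apply/eqP; rewrite eqn_leq (mnm_lepP leug).
  by rewrite -(eq_dvd _ _ Gg Gg' (lepm_trans leu leug)) (mnm_lepP leu).
by have [g Gg /(mint _ (leadG g Gg)) eqt] := dvdG t Ft; exists g.
Qed.

(** This is the division algorithm: the highest monomial of [f] is cancelled by an ideal element if
    it is in [lead F], and is otherwise moved to the remainder. Termination is well-founded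
    induction on the bound [t]. *)
Lemma exists_normal_form F t f : (forall u, u \in msupp f -> le u t) ->
  exists r, ideal_gen F (f - r) /\
    forall u, u \in msupp r -> le u t /\ ~ lead F u.
Proof.
move: t f; apply: mord_ind => t IHt f lef.
have [->|f0] := eqVneq f 0.
  by exists 0; split=> [|u]; rewrite ?msupp0 // subrr; exact: ideal_gen0.
(* Covers both cases: [h] is an ideal element or the highest monomial of [f]. Over Z_2 equal highest
   monomials cancel in [f - h]. *)
have reduce h : HT le h = HT le f -> h != 0 ->
    exists r, ideal_gen F (f - h - r) /\
    forall u, u \in msupp r -> le u t /\ ~ lead F u.
  move=> eqHT h0; have [eq0|] := eqVneq (f - h) 0.
    exists 0; rewrite eq0 subrr; split=> [|u]; first exact: ideal_gen0.
    by rewrite msupp0.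
  move=> /HT_msupp; set v := HT le _; rewrite msuppB_F2 => vfh.
  have levt : le (HT le f) t by apply/lef/HT_msupp.
  have lev : le v (HT le f).
    move: vfh; case: (boolP (v \in msupp f)) => [/HT_max//|_ /HT_max].
    by rewrite eqHT.
  have nev : v <> t.
    move=> eqv; move: vfh; suff -> : v = HT le f by rewrite -{2}eqHT !HT_msupp.
    by apply: (mord_anti Hle); rewrite lev eqv.
  have [|r [Fr rP]] := IHt v (mord_trans Hle lev levt) nev (f - h).
    by move=> u; exact: HT_max.
  exists r; split=> // u /rP[leuv]; split=> //.
  exact: (mord_trans Hle leuv (mord_trans Hle lev levt)).
have [[h [Fh h0 eqHT]]|nF] := pselect (lead F (HT le f)).
  have [r [Fr rP]] := reduce h eqHT h0; exists r; split=> //.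
  by rewrite -(subrK h f) addrAC; exact: ideal_genD.
have [r [Fr rP]] := reduce _ (HT_X _) (mpolyX_neq0 _).
exists (r + 'X_[HT le f]); split; first by rewrite opprD addrA addrAC.
move=> u; rewrite addr_F2 msuppB_F2 msuppX inE; have [->|_] := eqVneq.
  by split=> //; apply/lef/HT_msupp.
by rewrite addbF => /rP.
Qed.

Lemma exists_reduced_groebner_basis F : exists G, reduced_groebner_basis le F G.
Proof.
have /choice[r rP] m : exists r, ideal_gen F ('X_[m] - r) /\
    forall u, u \in msupp r -> le u m /\ ~ lead F u.
  apply: exists_normal_form => u; rewrite msuppX inE => /eqP->.
  exact: (mord_refl Hle).
pose b m := 'X_[m] - r m.
(* The remainder [r m] has no monomial in [lead F], so it cannot cancel [m]. *)
have b_supp m u : lead F m ->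
    (u \in msupp (b m)) = (u == m) || (u \in msupp (r m)).
  move=> Fm; rewrite msuppB_F2 msuppX inE.
  by have [->|//] := eqVneq; case: (boolP (m \in _)) => // /((rP m).2 _)[].
have b_HT m : lead F m -> HT le (b m) = m.
  move=> Fm; apply: HT_eq => [|u]; first by rewrite b_supp ?eqxx.
  rewrite b_supp // => /predU1P[->|/((rP m).2 _)[]//].
  exact: (mord_refl Hle).
have b0 m : lead F m -> b m != 0.
  by move=> Fm; apply: (@neq0_msupp _ m); rewrite b_supp ?eqxx.
have bF m : ideal_gen F (b m) by case: (rP m).
exists (b @` min_lead F); split; first split.
- apply: finite_image; apply: antichain_finite => t u [Ft _] [_ minu] letu.
  exact: minu.
- by move=> _ [m _ <-].
- apply/seteqP; split; apply: ideal_gen_sub => _ [g [Gg g0] <-].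
    by apply: ideal_gen_mem; exists g => //; split=> //; case: Gg => m _ <-.
  have leadg : lead F (HT le g) by exists g.
  have [m lem min_m] := exists_minimal_divisor leadg.
  apply/HT_idealP; exists (b m); have Fm := min_m.1.
  by split; [exists m|exact: b0|rewrite b_HT].
- move=> _ [m [Fm minm] <-]; split.
    by rewrite mcoeff_F2 HT_msupp ?b0.
  (* If [m'] divides a monomial [t] of [b m], then either [t = m], and minimality forces [m' = m],
     or [t] occurs in [r m], although it is in [lead F] as a multiple of [m']. *)
  move=> t tb /HT_idealP[_ [[[m' [Fm' minm'] <-] neq] _]].
  rewrite b_HT // => lem't.
  move: tb; rewrite b_supp // => /predU1P[eqt|/((rP m).2 _)[_]].
    by apply: neq; rewrite /= (minm m') // -eqt.
  by apply; apply: lead_dvd lem't.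
Qed.

End MonomialOrdering.
End ReducedGroebnerBases.

Theorem theorem3p3 (n : nat) (le : rel 'X_{1..n}) (Hle : monomial_ordering le)
    (F : set {mpoly 'F_2[n]}) :
  Gb le F #= Min_tri (nonresidual le F).
Proof.
have redGb := xgetPex set0 (exists_reduced_groebner_basis Hle F).
have [HT_inj HT_img] := reduced_HT Hle redGb.
(* Both sides are in bijection with [min_lead F]: the minimal polynomials through ['X_[t]], the
   basis through [HT]. *)
rewrite (Min_tri_nonresidual Hle) (card_eqr (inj_card_eq _)); last first.
  by move=> t u _ _ /(congr1 (HT le)); rewrite !(HT_X Hle).
by rewrite -HT_img card_eq_sym; apply: inj_card_eq.
Qed.
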